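(* Let $j$ be an integer and $n$ a non-negative integer. Then \[ \sum_{k=0}^n\binom{n}{k}\frac{2^kF_{jk}}{L_j^k}B_{n-k}=\frac{n}{\sqrt5}\Big(\frac{\sqrt5F_j}{L_j}\Big)^{n-1}\quad\text{if } n \text{ is even}, \] \[ \sum_{k=0}^n\binom{n}{k}\frac{2^kL_{jk}}{L_j^k}B_{n-k}=n\Big(\frac{\sqrt5F_j}{L_j}\Big)^{n-1}\quad\text{if } n \text{ is odd}. \]
   Context: $\alpha=\frac{1+\sqrt5}{2}$, $\beta=\frac{1-\sqrt5}{2}$. For every integer $s$, $F_s=\frac{\alpha^s-\beta^s}{\sqrt5}$ and $L_s=\alpha^s+\beta^s$ (Fibonacci and Lucas numbers extended to all integers). The Bernoulli numbers $B_n$ are defined by $\sum_{n\ge0}B_n\frac{z^n}{n!}=\frac{z}{e^z-1}$. For $n=0$ the right-hand side of the first identity is interpreted as $0$. *)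

(* Defs.v *)
From Stdlib Require Import Reals ZArith.
From Coquelicot Require Import Coquelicot.
Open Scope R_scope.

Definition alpha : R := (1 + sqrt 5) / 2.
Definition beta : R := (1 - sqrt 5) / 2.

Definition F (s : Z) : R := (powerRZ alpha s - powerRZ beta s) / sqrt 5.
Definition L (s : Z) : R := powerRZ alpha s + powerRZ beta s.

(* [B] is the sequence of Bernoulli numbers:
   sum_(n >= 0) B_n z^n / n! = z / (exp z - 1) near z = 0.  The point z = 0
   itself, where the right-hand side is a removable 0/0, is left out; this
   still determines every B_n (with B_0 = 1 and B_1 = -1/2). *)
Definition is_bernoulli (B : nat -> R) : Prop :=
  locally' 0 (fun z : R =>
    is_pseries (fun n : nat => B n / INR (fact n)) z (z / (exp z - 1))).

(* Main.v *)
Require Import Defs.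
From Stdlib Require Import Reals ZArith Lia Lra.
From Coquelicot Require Import Coquelicot.
Open Scope R_scope.

(** With [x = sqrt 5 * F j / L j], Binet's formulas give [2 alpha^j / L j = 1 + x]
    and [2 beta^j / L j = 1 - x], so the two sums are [(P (1 + x) - P (1 - x)) / sqrt 5]
    and [P (1 + x) + P (1 - x)], where [P] is the [n]-th Bernoulli polynomial.
    Writing [f z = z / (exp z - 1)], the relation [f (- z) = f z * exp z] yields
    [f z * exp ((1 + x) z) - f (- z) * exp ((1 - x) (- z)) = z * exp (x z)], and comparing
    coefficients gives [P (1 + x) - (-1)^n P (1 - x) = n x^(n - 1)]. *)

Definition bernoulli_poly (B : nat -> R) (n : nat) (y : R) : R :=
  sum_f_R0 (fun k : nat => Binomial.C n k * y ^ k * B (n - k)%nat) n.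

Definition exp_coef (y : R) (n : nat) : R := y ^ n / INR (fact n).

(** Strictly outside the disk of convergence the terms do not tend to 0, so the series cannot
    converge there. *)
Lemma CV_radius_ge_ex_pseries (a : nat -> R) (z : R) :
  ex_pseries a z -> Rbar_le (Rabs z) (CV_radius a).
Proof.
  intros Ha.
  destruct (Rbar_le_lt_dec (Rabs z) (CV_radius a)) as [H | H]; [exact H |].
  exfalso; apply (CV_disk_outside _ _ H), ex_series_lim_0.
  now apply ex_pseries_R.
Qed.

Lemma is_pseries_exp_coef (y z : R) : is_pseries (exp_coef y) z (exp (y * z)).
Proof.
  apply is_pseries_R.
  apply is_series_ext with (fun n => / INR (fact n) * (y * z) ^ n).
  - intros n; unfold exp_coef; simpl; rewrite Rpow_mult_distr; unfold Rdiv; ring.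
  - apply is_pseries_R, is_exp_Reals.
Qed.

Lemma CV_radius_exp_coef (y : R) : CV_radius (exp_coef y) = p_infty.
Proof.
  pose proof (fun z => CV_radius_ge_ex_pseries _ _ (ex_intro _ _ (is_pseries_exp_coef y z))) as H.
  destruct (CV_radius (exp_coef y)) as [r | |]; [| reflexivity | now destruct (H 0)].
  specialize (H (Rabs r + 1)); simpl in H.
  pose proof (Rle_abs r); pose proof (Rle_abs (Rabs r + 1)); lra.
Qed.

Lemma exp_neq_1 (z : R) : z <> 0 -> exp z <> 1.
Proof.
  intros Hz H; apply Hz, exp_inv; now rewrite exp_0.
Qed.

(** Since [Binomial.C n k] is n! / (k! (n - k)!), the binomial convolution is a Cauchy product of
    exponential generating functions, here those of exp (y z) and z / (exp z - 1). *)
Lemma bernoulli_poly_PS_mult (B : nat -> R) (n : nat) (y : R) :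
  bernoulli_poly B n y
  = INR (fact n) * PS_mult (exp_coef y) (fun k => B k / INR (fact k)) n.
Proof.
  unfold bernoulli_poly, PS_mult; rewrite scal_sum; apply sum_eq; intros k _.
  unfold exp_coef, Binomial.C; field.
  split; apply INR_fact_neq_0.
Qed.

Lemma is_pseries_alternate (a : nat -> R) (z l : R) :
  is_pseries a (- z) l -> is_pseries (fun n => (-1) ^ n * a n) z l.
Proof.
  intros H; apply is_pseries_R; apply is_pseries_R in H.
  revert H; apply is_series_ext; intros n.
  replace (- z) with (-1 * z) by ring; simpl; rewrite Rpow_mult_distr; ring.
Qed.

Lemma bernoulli_poly_reflection (B : nat -> R) (hB : is_bernoulli B) (x : R) (n : nat) :
  bernoulli_poly B n (1 + x) - (-1) ^ n * bernoulli_poly B n (1 - x)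
  = INR n * x ^ (n - 1).
Proof.
  set (b := fun k => B k / INR (fact k)).
  set (lhs := PS_minus (PS_mult (exp_coef (1 + x)) b)
                (fun n => (-1) ^ n * PS_mult (exp_coef (1 - x)) b n)).
  set (rhs := PS_incr_1 (exp_coef x)).
  destruct hB as [eps Heps].
  assert (Hb : forall z, Rabs z < eps -> z <> 0 -> is_pseries b z (z / (exp z - 1))).
  { intros z Hz Hz0; apply Heps; [| exact Hz0].
    change (Rabs (z - 0) < eps); now rewrite Rminus_0_r. }
  (* Convergence at the single nonzero point [eps / 2] bounds the radius below. Halving [eps] gives
     the strict inequality that the Cauchy product requires. *)
  assert (Hrad : forall z, Rabs z < eps / 2 -> Rbar_lt (Rabs z) (CV_radius b)).
  { intros z Hz; pose proof (cond_pos eps).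
    apply Rbar_lt_le_trans with (Rabs (eps / 2)).
    - rewrite (Rabs_pos_eq (eps / 2)) by lra; exact Hz.
    - apply CV_radius_ge_ex_pseries; eexists; apply Hb; [rewrite Rabs_pos_eq |]; lra. }
  assert (Hm : forall y z, Rabs z < eps / 2 -> z <> 0 ->
    is_pseries (PS_mult (exp_coef y) b) z (exp (y * z) * (z / (exp z - 1)))).
  { intros y z Hz Hz0; pose proof (cond_pos eps); apply is_pseries_mult.
    - apply is_pseries_exp_coef.
    - apply Hb; [lra | exact Hz0].
    - now rewrite CV_radius_exp_coef.
    - now apply Hrad. }
  assert (Hl : forall z, Rabs z < eps / 2 -> z <> 0 -> is_pseries lhs z (z * exp (x * z))).
  { intros z Hz Hz0.
    replace (z * exp (x * z)) with
      (minus (exp ((1 + x) * z) * (z / (exp z - 1)))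
             (exp ((1 - x) * - z) * (- z / (exp (- z) - 1)))).
    - apply (is_pseries_minus (K := R_AbsRing) (V := R_NormedModule)); [now apply Hm |].
      apply is_pseries_alternate, Hm; [now rewrite Rabs_Ropp | lra].
    - unfold minus, plus, opp; simpl.
      replace ((1 + x) * z) with (z + x * z) by ring.
      replace ((1 - x) * - z) with (- z + x * z) by ring.
      rewrite !exp_plus, exp_Ropp.
      pose proof (exp_pos z); pose proof (exp_neq_1 z Hz0).
      field; repeat split; lra. }
  assert (Hcoef : lhs n = rhs n).
  { pose proof (cond_pos eps).
    (* Uniqueness of coefficients: both radii must be positive ([eps / 4] is a witness for [lhs])
       and the sums must agree on a full neighbourhood of 0. *)
    apply PSeries_ext_recip.
    - apply Rbar_lt_le_trans with (Rabs (eps / 4)).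
      + rewrite Rabs_pos_eq; simpl; lra.
      + apply CV_radius_ge_ex_pseries; eexists; apply Hl; [rewrite Rabs_pos_eq |]; lra.
    - unfold rhs; now rewrite CV_radius_incr_1, CV_radius_exp_coef.
    - assert (He : 0 < eps / 2) by lra.
      exists (mkposreal _ He); intros z Hz.
      change (Rabs (z - 0) < eps / 2) in Hz; rewrite Rminus_0_r in Hz.
      (* [Hl] excludes z = 0. There the sums are the constant coefficients: [b 0 - b 0] on the left,
         and 0 on the right because of the shift. *)
      destruct (Req_dec z 0) as [-> | Hz0].
      + rewrite !PSeries_0.
        unfold lhs, rhs, PS_minus, PS_plus, PS_opp, PS_mult, exp_coef; simpl.
        unfold plus, opp, zero; simpl; field.
      + rewrite (is_pseries_unique _ _ _ (Hl z Hz Hz0)).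
        unfold rhs; rewrite PSeries_incr_1.
        now rewrite (is_pseries_unique _ _ _ (is_pseries_exp_coef x z)). }
  rewrite !bernoulli_poly_PS_mult; fold b.
  transitivity (INR (fact n) * lhs n).
  { unfold lhs, PS_minus, PS_plus, PS_opp, plus, opp; simpl; ring. }
  rewrite Hcoef; unfold rhs, PS_incr_1, exp_coef.
  destruct n as [| m]; [unfold zero; simpl; ring |].
  replace (S m - 1)%nat with m by lia.
  rewrite fact_simpl, mult_INR; field; apply INR_fact_neq_0.
Qed.

Lemma alpha_beta : alpha * beta = -1.
Proof.
  unfold alpha, beta; pose proof (sqrt_sqrt 5); lra.
Qed.

Lemma alpha_neq_0 : alpha <> 0.
Proof.
  intros H; pose proof alpha_beta; rewrite H in *; lra.
Qed.

Lemma beta_neq_0 : beta <> 0.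
Proof.
  intros H; pose proof alpha_beta; rewrite H in *; lra.
Qed.

(** Since [beta] is negative, the terms are not all positive. Instead, the Lucas recurrence
    propagates positivity from two consecutive values, starting with 2 and 1. *)
Lemma pow_alpha_beta_pos (n : nat) : 0 < alpha ^ n + beta ^ n.
Proof.
  assert (H5 : sqrt 5 * sqrt 5 = 5) by (apply sqrt_sqrt; lra).
  enough (0 < alpha ^ n + beta ^ n /\ 0 < alpha ^ S n + beta ^ S n) by tauto.
  induction n as [| n [IH0 IH1]].
  - unfold alpha, beta; simpl; lra.
  - split; [exact IH1 |].
    replace (alpha ^ S (S n) + beta ^ S (S n))
      with ((alpha ^ S n + beta ^ S n) + (alpha ^ n + beta ^ n)); [lra |].
    assert (Ha : alpha * alpha = alpha + 1) by (unfold alpha; lra).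
    assert (Hb : beta * beta = beta + 1) by (unfold beta; lra).
    simpl; rewrite <- !(Rmult_assoc alpha alpha), <- !(Rmult_assoc beta beta), Ha, Hb; ring.
Qed.

Lemma L_neq_0 (j : Z) : L j <> 0.
Proof.
  unfold L; destruct j as [| p | p]; simpl; [lra | |];
    pose proof (pow_alpha_beta_pos (Pos.to_nat p)) as H; [lra |].
  pose proof (pow_nonzero _ (Pos.to_nat p) alpha_neq_0).
  pose proof (pow_nonzero _ (Pos.to_nat p) beta_neq_0).
  (* A negative index reduces to the positive one over a common denominator. *)
  replace (/ alpha ^ Pos.to_nat p + / beta ^ Pos.to_nat p)
    with ((alpha ^ Pos.to_nat p + beta ^ Pos.to_nat p)
          / (alpha ^ Pos.to_nat p * beta ^ Pos.to_nat p)) by (field; auto).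
  apply Rmult_integral_contrapositive_currified; [lra |].
  apply Rinv_neq_0_compat; now apply Rmult_integral_contrapositive_currified.
Qed.

Lemma powerRZ_mul_nat (x : R) (j : Z) (k : nat) :
  x <> 0 -> powerRZ x (j * Z.of_nat k) = powerRZ x j ^ k.
Proof.
  intros Hx; induction k as [| k IHk].
  - now rewrite Z.mul_0_r.
  - rewrite Nat2Z.inj_succ, Z.mul_succ_r, powerRZ_add, IHk by exact Hx; simpl; ring.
Qed.

(* For n = 0 the truncated exponent n - 1 is harmless: the
   factor n makes the right-hand side 0. *)
Theorem theorem16 (B : nat -> R) (hB : is_bernoulli B) (j : Z) (n : nat) :
  (Nat.Even n ->
     sum_f_R0 (fun k : nat =>
         Binomial.C n k * (2 ^ k * F (j * Z.of_nat k)%Z / L j ^ k) * B (n - k)%nat) n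
     = INR n / sqrt 5 * (sqrt 5 * F j / L j) ^ (n - 1)) /\
  (Nat.Odd n ->
     sum_f_R0 (fun k : nat =>
         Binomial.C n k * (2 ^ k * L (j * Z.of_nat k)%Z / L j ^ k) * B (n - k)%nat) n
     = INR n * (sqrt 5 * F j / L j) ^ (n - 1)).
Proof.
  pose proof (L_neq_0 j) as HL.
  assert (H5 : sqrt 5 <> 0) by (apply Rgt_not_eq, sqrt_lt_R0; lra).
  set (x := sqrt 5 * F j / L j).
  assert (Hu : 2 * powerRZ alpha j / L j = 1 + x).
  { unfold x, F; revert HL; unfold L; intros HL; field; auto. }
  assert (Hv : 2 * powerRZ beta j / L j = 1 - x).
  { unfold x, F; revert HL; unfold L; intros HL; field; auto. }
  (* Used with p = alpha^j and p = beta^j, this matches the two Binet terms of each summand with (1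
     + x)^k and (1 - x)^k. *)
  assert (Hpow : forall (p y : R) (k : nat), 2 * p / L j = y -> 2 ^ k * p ^ k / L j ^ k = y ^ k).
  { intros p y k <-; unfold Rdiv; now rewrite !Rpow_mult_distr, pow_inv. }
  pose proof (bernoulli_poly_reflection B hB x n) as Hrefl.
  pose proof (fun k => Hpow _ _ k Hu) as Huk.
  pose proof (fun k => Hpow _ _ k Hv) as Hvk.
  split; intros [m Hm].
  - replace ((-1) ^ n) with 1 in Hrefl by (now rewrite Hm, pow_1_even).
    transitivity (/ sqrt 5 * (bernoulli_poly B n (1 + x) - 1 * bernoulli_poly B n (1 - x)));
      [| rewrite Hrefl; unfold Rdiv; ring].
    rewrite Rmult_1_l; unfold bernoulli_poly; rewrite <- minus_sum, scal_sum.
    apply sum_eq; intros k _.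
    unfold F; rewrite !powerRZ_mul_nat, <- Huk, <- Hvk by auto using alpha_neq_0, beta_neq_0.
    field; split; auto using pow_nonzero.
  - replace ((-1) ^ n) with (-1) in Hrefl
      by (now rewrite Hm, Nat.add_1_r, pow_1_odd).
    rewrite <- Hrefl.
    transitivity (bernoulli_poly B n (1 + x) + bernoulli_poly B n (1 - x)); [| ring].
    unfold bernoulli_poly; rewrite <- sum_plus.
    apply sum_eq; intros k _.
    (* Only the numerator is expanded. The denominator [L j] stays opaque, so that [field] can use
       [HL]. *)
    unfold L at 1; rewrite !powerRZ_mul_nat, <- Huk, <- Hvk by auto using alpha_neq_0, beta_neq_0.
    field; now apply pow_nonzero.
Qed.
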